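(* For every $n\ge 1$ there exists an $(n-1,n)$-stopping rule with stopping time $\tau$ such that for every continuous distribution $F$ on $\mathbb{R}_+$, when $X_1,\dots,X_n$ and the samples are i.i.d.\ from $F$, \[ \mathbb{E}[X_\tau]=\Big(1-\big(1-\tfrac1n\big)^n\Big)\cdot\mathbb{E}[\max\{X_1,\dots,X_n\}]. \]
   Context: Let $k\in\mathbb{N}_0$, $n\in\mathbb{N}$. Values $X_1,\dots,X_n$ and samples $S_1,\dots,S_k$ are i.i.d.\ according to a distribution $F$ on $\mathbb{R}_+$ (unknown to the rule). A $(k,n)$-stopping rule is a family $r_1,\dots,r_n$, $r_i:\mathbb{R}_+^{k+i}\to[0,1]$, where $r_i(s_1,\dots,s_k,x_1,\dots,x_i)$ is the probability of stopping at $X_i$ given samples $s$, values $x_1,\dots,x_i$, and not having stopped earlier; the rule does not depend on $F$. Its stopping time $\tau$ satisfies $\Pr[\tau=i\mid S=s,X=x]=\prod_{j<i}(1-r_j(s,x_1,\dots,x_j))\,r_i(s,x_1,\dots,x_i)$, with $X_\infty:=0$. *)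

(* Defs.v *)
From mathcomp Require Import all_boot all_order all_algebra.
From mathcomp Require Import all_classical all_reals all_analysis.

Set Implicit Arguments.
Unset Strict Implicit.
Unset Printing Implicit Defensive.

Import Order.TTheory GRing.Theory Num.Theory.
Import numFieldNormedType.Exports.

Local Open Scope classical_set_scope.
Local Open Scope ring_scope.

Definition nneg_orthant (R : realType) (m : nat) : set (m.-tuple R) :=
  [set t | forall j, 0 <= tnth t j].
#[global] Arguments nneg_orthant : clear implicits.

(* R_+^k x R_+^m *)
Definition nneg_inputs (R : realType) (k m : nat) :
    set (k.-tuple R * m.-tuple R) :=
  nneg_orthant R k `*` nneg_orthant R m.
#[global] Arguments nneg_inputs : clear implicits.

(* Steps are numbered from 0, so the rule at step [i : 'I_n] sees the k samples
   and i.+1 values.  A rule is only constrained on nonnegative inputs; its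
   values elsewhere are junk.  Measurability makes the law of the stopping time meaningful. *)
Record stopping_rule (R : realType) (k n : nat) := StoppingRule {
  rule_fun :> forall i : 'I_n, k.-tuple R * i.+1.-tuple R -> R ;
  rule_measurable : forall i : 'I_n,
    measurable_fun (nneg_inputs R k i.+1) (@rule_fun i) ;
  rule_prob : forall (i : 'I_n) z, nneg_inputs R k i.+1 z ->
    0 <= @rule_fun i z <= 1
}.

(* (x_0, ..., x_i) *)
Definition values_upto (R : realType) (n : nat) (i : 'I_n) (x : n.-tuple R) :
    i.+1.-tuple R :=
  [tuple tnth x (widen_ord (ltn_ord i) j) | j < i.+1].

Definition stop_prob (R : realType) (k n : nat) (r : stopping_rule R k n)
    (i : 'I_n) (z : k.-tuple R * n.-tuple R) : R :=
  (\prod_(j < n | (j < i)%N) (1 - r j (z.1, values_upto j z.2)))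
  * r i (z.1, values_upto i z.2).

Section Model.
Context d (Omega : measurableType d) (R : realType) (P : probability Omega R).

Definition mutually_independent (I : finType) (Y : I -> {RV P >-> R}) : Prop :=
  forall (J : {set I}) (B : I -> set R), (forall i, measurable (B i)) ->
    P (\bigcap_(i in [set` J]) (Y i @^-1` B i))
    = (\prod_(i in J) P (Y i @^-1` B i))%E.

Definition iid (F : probability R R) (I : finType) (Y : I -> {RV P >-> R}) :
    Prop :=
  mutually_independent Y
  /\ forall i (B : set R), measurable B -> distribution P (Y i) B = F B.

Variables (k n : nat) (S : 'I_k -> {RV P >-> R}) (X : 'I_n -> {RV P >-> R}).

Definition joint_family (j : 'I_k + 'I_n) : {RV P >-> R} :=
  match j with inl a => S a | inr b => X b end.

Definition joint_vector (w : Omega) : k.-tuple R * n.-tuple R :=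
  ([tuple S j w | j < k], [tuple X j w | j < n]).

(* [None] is the value oo (never stopping).  The last clause is the defining
   property of P[tau = i | S = s, X = x] = stop_prob r i (s, x) on the domain
   R_+^k x R_+^n of the rule. *)
Definition is_stopping_time (r : stopping_rule R k n)
    (tau : Omega -> option 'I_n) : Prop :=
  (forall i : 'I_n, measurable (tau @^-1` [set Some i]))
  /\ forall (i : 'I_n) (A : set (k.-tuple R * n.-tuple R)),
      measurable A -> A `<=` nneg_inputs R k n ->
      P (tau @^-1` [set Some i] `&` joint_vector @^-1` A)
      = (\int[P]_(w in joint_vector @^-1` A)
           (stop_prob r i (joint_vector w))%:E)%E.

Definition stopped_value (tau : Omega -> option 'I_n) (w : Omega) : R :=
  if tau w is Some i then X i w else 0.

(* The neutral element 0 is harmless: the values are almost surely nonnegative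
   and n is positive in use. *)
Definition max_value (w : Omega) : R := \big[Num.max/0]_(i < n) X i w.

End Model.

(* A distribution on R_+ with continuous cumulative distribution function; a
   density is not required. *)
Definition continuous_distribution (R : realType) (F : probability R R) : Prop :=
  F `[0, +oo[%classic = 1%E
  /\ continuous (fun x : R => F `]-oo, x]%classic).

(* Main.v *)
(** At step [i] the rule draws a uniformly random subset of [n - 1] of the
    [n - 1 + i] entries (samples and values) seen before, and stops if the
    current value exceeds all of them.  Given the unordered set of entries seen
    so far, the current value together with the random subset is a random
    [n]-subset with a random distinguished element, so the rule stops with
    probability [1/n] whatever that set is: not having stopped is independent of
    the unordered set of past entries, and the rule always faces a fresh i.i.d.
    sample.  When it stops, the accepted value is the maximum of [n] i.i.d.
    draws.  Hence the step [i] contributes [(1 - 1/n)^i (1/n) E max].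
    Conditioning is replaced by exchangeability: entries are swapped inside
    integrals of functions symmetric in the past entries. *)
From HB Require Import structures.
Require Import Defs.
From mathcomp Require Import all_boot all_order all_algebra all_fingroup.
From mathcomp Require Import all_classical all_reals all_analysis.
From mathcomp Require Import measurable_realfun.

Import Order.TTheory GRing.Theory Num.Theory.
Import numFieldNormedType.Exports.

Local Open Scope classical_set_scope.
Local Open Scope ring_scope.

Set Implicit Arguments.
Unset Strict Implicit.
Unset Printing Implicit Defensive.

(** * Functions of a random finite set *)

(** Only finitely many sets can occur, so the function is a finite sum over candidates [V], each
    weighted by a product of measurable indicators. It serves [beats] and [acc_prob], which depend
    on the random set of entries below a given one. *)
Lemma measurable_fun_setpred d (T : measurableType d) (R : realType)
    (F : finType) (b : F -> T -> bool) (h : {set F} -> R) :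
  (forall i, measurable_fun setT (b i)) ->
  measurable_fun setT (fun x => h [set i | b i x]%SET).
Proof.
move=> mb.
rewrite (_ : (fun _ => _) = fun x =>
    \sum_(V : {set F}) h V * \prod_(i : F) (b i x == (i \in V))%:R); last first.
  apply/funext => x; rewrite (bigD1 [set i | b i x]%SET) //=.
  rewrite big1 ?mulr1 => [|i _]; last by rewrite inE eqxx.
  rewrite big1 ?addr0 // => V neV; apply/eqP; rewrite mulf_eq0; apply/orP.
  right; apply/prodf_eq0; have /existsP[i] : [exists i, b i x != (i \in V)].
    apply: contraR neV => /existsPn eqV; apply/eqP/setP => i.
    by rewrite inE; have /negPn/eqP -> := eqV i.
  by move=> /negPf ne; exists i; rewrite ?ne.
apply: measurable_sum => V; apply: measurable_funM => //.
apply: measurable_prod => i _.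
rewrite (_ : (fun _ => _) =
    fun x => if b i x then (i \in V)%:R else (i \notin V)%:R :> R).
  exact: measurable_fun_ifT.
by apply/funext => x; case: (b i x); case: (i \in V).
Qed.

(** * Samples and values as one indexed family *)

Section Entries.
Context (R : realType) (k n : nat).
Notation I := ('I_k + 'I_n)%type.
Notation Z := (k.-tuple R * n.-tuple R)%type.
Implicit Types (z : Z) (a b m : I) (A B Q : {set I}) (s : {perm I}).

(** The sum type as index set lets a permutation exchange a sample with a value. *)
Definition entry z a : R :=
  match a with inl j => tnth z.1 j | inr i => tnth z.2 i end.

Definition permute s z : Z :=
  ([tuple entry z (s (inl j)) | j < k], [tuple entry z (s (inr i)) | i < n]).

Lemma entry_permute s z a : entry (permute s z) a = entry z (s a).
Proof. by case: a => a /=; rewrite tnth_mktuple. Qed.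

Lemma measurable_entry a : measurable_fun setT (entry ^~ a).
Proof.
case: a => i; rewrite /entry.
  exact: (measurableT_comp (@measurable_tnth _ _ _ i) measurable_fst).
exact: (measurableT_comp (@measurable_tnth _ _ _ i) measurable_snd).
Qed.

Lemma measurable_fun_entries d (T : measurableType d) (f : T -> Z) :
  (forall a, measurable_fun setT (fun w => entry (f w) a)) ->
  measurable_fun setT f.
Proof.
move=> mf; apply/measurable_fun_pairP; split; apply/measurable_fun_tnthP => i.
  exact: mf (inl i).
exact: mf (inr i).
Qed.

Lemma measurable_permute s : measurable_fun setT (permute s).
Proof.
apply: measurable_fun_entries => a.
by under eq_fun do rewrite entry_permute; exact: measurable_entry.
Qed.

Definition beats m A z : bool := [forall (a | a \in A), entry z a < entry z m].

Lemma beatsP m A z :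
  reflect (forall a, a \in A -> entry z a < entry z m) (beats m A z).
Proof. exact: forall_inP. Qed.

Lemma measurable_beats m A :
  measurable_fun setT (fun z => (beats m A z)%:R : R).
Proof.
rewrite (_ : (fun _ => _) =
    fun z => (A \subset [set a | entry z a < entry z m]%SET)%:R :> R).
  apply: (measurable_fun_setpred
    (fun V : {set I} => (A \subset V)%:R : R)) => a.
  by apply: measurable_fun_ltr; exact: measurable_entry.
apply/funext => z; congr (nat_of_bool _)%:R.
apply/beatsP/fintype.subsetP => h a /h; by rewrite inE.
Qed.

(* Probability that a uniformly random subset of [c] elements of [Q] lies
   entirely below [m]; it is 0 (as 0 / 0) when [Q] has fewer elements. *)
Definition acc_prob c Q m z : R :=
  'C(#|[set a in Q | entry z a < entry z m]%SET|, c)%:R / 'C(#|Q|, c)%:R.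

Lemma measurable_acc_prob c Q m : measurable_fun setT (acc_prob c Q m).
Proof.
apply: measurable_funM => //.
rewrite (_ : (fun _ => _) = fun z =>
  'C(#|Q :&: [set a | entry z a < entry z m]%SET|, c)%:R :> R).
  apply: (measurable_fun_setpred
    (fun V : {set I} => 'C(#|Q :&: V|, c)%:R : R)) => a.
  by apply: measurable_fun_ltr; exact: measurable_entry.
apply/funext => z; congr ('C(#|pred_of_set _|, c)%:R).
by apply/setP => a; rewrite !inE.
Qed.

Lemma acc_prob_itv c Q m z : 0 <= acc_prob c Q m z <= 1.
Proof.
rewrite /acc_prob divr_ge0 //=.
have [->|C0] := eqVneq 'C(#|Q|, c) 0%N; first by rewrite invr0 mulr0.
rewrite ler_pdivrMr ?ltr0n ?lt0n //.
rewrite mul1r ler_nat leq_bin2l // subset_leq_card //.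
by apply/fintype.subsetP => a; rewrite inE => /andP[].
Qed.

(** The numerator counts the [c]-subsets of [Q] lying below [m], so acceptance is an average over
    fixed subsets; this reduces later integrals to [beats]. If [Q] is too small, both sides are
    0. *)
Lemma acc_probE c Q m z : acc_prob c Q m z =
  ('C(#|Q|, c)%:R)^-1 *
  \sum_(A : {set I} | (A \subset Q) && (#|A| == c)) (beats m A z)%:R.
Proof.
rewrite /acc_prob mulrC; congr (_ * _).
rewrite -natr_sum -cards_draws -sum1dep_card big_mkcond [in RHS]big_mkcond /=.
congr _%:R; apply: eq_bigr => A _.
have -> : (A \subset [set a in Q | entry z a < entry z m]%SET) =
    (A \subset Q) && beats m A z.
  apply/fintype.subsetP/andP => [h|[/fintype.subsetP AQ /beatsP b] a aA].
    split; first by apply/fintype.subsetP => a /h; rewrite inE => /andP[].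
    by apply/beatsP => a /h; rewrite inE => /andP[].
  by rewrite inE AQ //= b.
by case: (A \subset Q); case: beats; case: (#|A| == c).
Qed.

(** Only the number of entries of [Q] below [m] matters, and [s] merely relabels [Q]. *)
Lemma acc_prob_permute c Q m s z :
  s m = m -> (forall a, (s a \in Q) = (a \in Q)) ->
  acc_prob c Q m (permute s z) = acc_prob c Q m z.
Proof.
move=> sm sQ; rewrite /acc_prob; congr ('C(_, c)%:R / _).
rewrite -[RHS](card_imset _ (@perm_inj _ s^-1%g)).
apply: eq_card => a.
rewrite -[in RHS](permK s a) (mem_imset _ _ (@perm_inj _ s^-1%g)).
by rewrite !inE !entry_permute sm sQ.
Qed.
End Entries.

(** * Averages of integrals over a finite family *)

Lemma ge0_sume_const (R : realType) (K : finType) (P : {pred K}) (J : \bar R) :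
  (0 <= J -> \sum_(i in P) J = (#|P|%:R)%:E * J)%E.
Proof.
move=> J0; rewrite (eq_bigr (fun=> 1 * J)%E) => [|i _]; last by rewrite mul1e.
by rewrite -ge0_sume_distrl // sumEFin sumr_const.
Qed.

Lemma ge0_integral_mean d (T : measurableType d) (R : realType)
    (mu : {measure set T -> \bar R}) (K : finType) (P : {pred K})
    (h : K -> T -> R) (J : \bar R) : (0 < #|P|)%N ->
  (forall i, measurable_fun setT (h i)) -> (forall i x, 0 <= h i x) ->
  (forall i, i \in P -> \int[mu]_x (h i x)%:E = J)%E ->
  (\int[mu]_x (#|P|%:R^-1 * \sum_(i in P) h i x)%:E = J)%E.
Proof.
move=> P0 mh h0 hJ.
have -> : (\int[mu]_x (#|P|%:R^-1 * \sum_(i in P) h i x)%:E =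
    \int[mu]_x ((#|P|%:R^-1)%:E * \sum_(i <- enum P) (h i x)%:E))%E.
  by apply: eq_integral => x _; rewrite sumEFin big_enum EFinM.
rewrite ge0_integralZl //=; first last.
- by move=> x _; apply: sume_ge0 => i _; rewrite lee_fin.
- by apply: emeasurable_sum => i; exact/measurable_EFinP.
rewrite ge0_integral_sum //=; first last.
- by move=> i x _; rewrite lee_fin.
- by move=> i; exact/measurable_EFinP.
rewrite big_enum (eq_bigr (fun=> J)) // ge0_sume_const ?muleA -?EFinM.
  by rewrite mulVf ?mul1e // pnatr_eq0 -lt0n.
(* Any member of the nonempty [P] shows that [J], possibly infinite, is nonnegative. *)
have [i iP] := card_gt0P P0; rewrite -(hJ i iP).
by apply: integral_ge0 => x _; rewrite lee_fin.
Qed.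

(** * Exchangeability *)

Section Exchangeable.
Context (R : realType) (k n : nat).
Notation I := ('I_k + 'I_n)%type.
Notation Z := (k.-tuple R * n.-tuple R)%type.
Implicit Types (z : Z) (a b m : I) (A B Q : {set I}) (s : {perm I}).
Implicit Types (g : Z -> R).

(** Without ties the index of the largest entry is the only one that beats the rest of [B]; [m]
    provides nonemptiness. *)
Lemma sum_beats B m z : m \in B -> injective (entry z) ->
  \sum_(b in B) (beats b (B :\ b)%SET z)%:R = 1 :> R.
Proof.
move=> mB inj; case: (@arg_maxP _ R I m (mem B) (entry z) mB) => b bB' bmax'.
have bB : b \in B by [].
have bmax a : a \in B -> entry z a <= entry z b by exact: bmax'.
rewrite (bigD1 b) //= big1 => [|a /andP[aB ab]].
  rewrite addr0 (_ : beats _ _ _) //; apply/beatsP => a.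
  rewrite !inE => /andP[ab aB]; rewrite lt_neqAle bmax // andbT.
  by apply: contra ab => /eqP/inj ->.
apply/eqP; rewrite pnatr_eq0 eqb0; apply/negP => /beatsP/(_ b).
by rewrite !inE eq_sym ab bB => /(_ isT); rewrite ltNge bmax.
Qed.

(** Invariance under permutations and absence of ties are all that is assumed of the law in this
    section. Invariance concerns nonnegative functions, so integrals may be infinite. *)
Variable mu : {measure set Z -> \bar R}.
Hypothesis mu_permute : forall s (f : Z -> R), measurable_fun setT f ->
  (forall z, 0 <= f z) ->
  (\int[mu]_z (f (permute s z))%:E = \int[mu]_z (f z)%:E)%E.
Hypothesis mu_ties : forall a b, a != b ->
  mu [set z | entry z a = entry z b] = 0%E.

Lemma ae_injective_entry : {ae mu, forall z, injective (entry z)}.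
Proof.
suff : {ae mu, forall z, forall p : I * I,
    entry z p.1 = entry z p.2 -> p.1 = p.2}.
  by apply: filterS => z h a b; exact: (h (a, b)).
apply: filter_forall => -[a b] /=.
have [->|ab] := eqVneq a b; first exact: nearW.
exists [set z | entry z a = entry z b]; split => //=.
- rewrite (_ : mkset _ = (fun z => entry z a == entry z b) @^-1` [set true]).
    rewrite -[X in measurable X]setTI; apply: measurable_fun_eqr => //;
    exact: measurable_entry.
  by apply/seteqP; split => z /= /eqP.
- exact: mu_ties.
- by move=> z /=; apply: contra_notP => eqN /eqN.
Qed.

Lemma measurable_beatsM m A g : measurable_fun setT g ->
  measurable_fun setT (fun z => (beats m A z)%:R * g z).
Proof. by move=> mg; apply: measurable_funM => //; exact: measurable_beats. Qed.

(** The transposition of [a] and [m] exchanges the two events and fixes both [g] and the measure. *)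
Lemma integral_beats_swap m A a g : m \notin A -> a \in A ->
  measurable_fun setT g -> (forall z, 0 <= g z) ->
  (forall z, g (permute (tperm a m) z) = g z) ->
  (\int[mu]_z ((beats a ((m |: A) :\ a)%SET z)%:R * g z)%:E =
   \int[mu]_z ((beats m A z)%:R * g z)%:E)%E.
Proof.
move=> mA aA mg g0 gs.
rewrite -[RHS](mu_permute (tperm a m)).
- apply: eq_integral => z _; rewrite gs; congr ((_%:R * _)%:E).
  congr nat_of_bool; apply/beatsP/beatsP => h b.
    move=> bA; rewrite !entry_permute tpermR; apply: h.
    rewrite !inE; case: tpermP => [_|bm|/eqP -> _]; last by rewrite bA orbT.
      by rewrite eqxx andbT; apply: contraNneq mA => ->.
    by rewrite -bm bA in mA.
  rewrite !inE => /andP[ba /orP bB].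
  have := h (tperm a m b); rewrite !entry_permute tpermK tpermR; apply.
  case: tpermP => [bE|//|_ bm]; first by rewrite bE eqxx in ba.
  by case: bB => // /eqP.
- exact: measurable_beatsM.
- by move=> z; rewrite mulr_ge0.
Qed.

(* Almost surely exactly one index of [m |: A] beats all the others, and by
   symmetry of [g] each index contributes the same integral. *)
Lemma integral_beats_compl m A g : m \notin A ->
  measurable_fun setT g -> (forall z, 0 <= g z) ->
  (forall a z, a \in A -> g (permute (tperm a m) z) = g z) ->
  (\int[mu]_z ((1 - (beats m A z)%:R) * g z)%:E =
   (#|A|%:R)%:E * \int[mu]_z ((beats m A z)%:R * g z)%:E)%E.
Proof.
move=> mA mg g0 gs.
transitivity (\int[mu]_z (\sum_(a <- enum A)
    ((beats a ((m |: A) :\ a)%SET z)%:R * g z)%:E))%E.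
  apply: ge0_ae_eq_integral => //.
  - apply/measurable_EFinP; apply: measurable_funM => //.
    by apply: measurable_funB => //; exact: measurable_beats.
  - apply: emeasurable_sum => a; apply/measurable_EFinP.
    exact: measurable_beatsM.
  - by move=> z _; rewrite lee_fin mulr_ge0 // subr_ge0 lern1 leq_b1.
  - by move=> z _; apply: sume_ge0 => a _; rewrite lee_fin mulr_ge0.
  apply: filterS ae_injective_entry => z inj _.
  rewrite sumEFin -mulr_suml; congr ((_ * _)%:E).
  rewrite -[X in X - _](sum_beats (setU11 m A) inj) (bigD1 m) ?setU11 //=.
  rewrite setU1K //.
  rewrite addrAC subrr add0r big_enum; apply: eq_bigl => a.
  by rewrite !inE; case: eqVneq => [->|]; rewrite ?(negPf mA) ?andbF ?andbT.
rewrite ge0_integral_sum //=; last 2 first.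
- by move=> a; apply/measurable_EFinP; exact: measurable_beatsM.
- by move=> a z _; rewrite lee_fin mulr_ge0.
rewrite big_enum (eq_bigr (fun=>
  \int[mu]_z ((beats m A z)%:R * g z)%:E)%E) => [|a aA]; last first.
  by apply: integral_beats_swap => // z; rewrite gs.
rewrite ge0_sume_const //.
by apply: integral_ge0 => x _; rewrite lee_fin mulr_ge0.
Qed.

(** The integral of [g] splits into the part where [m] beats [A] and the complementary part, which
    is worth [#|A|] copies of the first. Adding rather than subtracting keeps infinite integrals
    admissible. *)
Lemma integral_beats m A g : m \notin A ->
  measurable_fun setT g -> (forall z, 0 <= g z) ->
  (forall a z, a \in A -> g (permute (tperm a m) z) = g z) ->
  (\int[mu]_z ((beats m A z)%:R * g z)%:E =
   ((#|A|.+1)%:R^-1)%:E * \int[mu]_z (g z)%:E)%E.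
Proof.
move=> mA mg g0 gs.
have -> : (\int[mu]_z (g z)%:E = (#|A|.+1%:R)%:E *
    \int[mu]_z ((beats m A z)%:R * g z)%:E)%E.
  rewrite -[#|A|.+1]add1n natrD EFinD ge0_muleDl ?lee_fin // mul1e.
  rewrite -integral_beats_compl // -ge0_integralD //.
  - by apply: eq_integral => z _; rewrite -EFinD -mulrDl addrC subrK mul1r.
  - by move=> z _; rewrite lee_fin mulr_ge0.
  - by apply/measurable_EFinP; exact: measurable_beatsM.
  - by move=> z _; rewrite lee_fin mulr_ge0 // subr_ge0 lern1 leq_b1.
  - apply/measurable_EFinP; apply: measurable_funM => //.
    by apply: measurable_funB => //; exact: measurable_beats.
by rewrite muleA -EFinM mulVf ?mul1e // pnatr_eq0.
Qed.

(** By [acc_probE] the random draw is a mean over fixed [c]-subsets, so it suffices that all of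
    these give the same integral. *)
Lemma integral_acc_prob c m Q g J : (c <= #|Q|)%N ->
  measurable_fun setT g -> (forall z, 0 <= g z) ->
  (forall A, A \subset Q -> #|A| = c ->
    \int[mu]_z ((beats m A z)%:R * g z)%:E = J)%E ->
  (\int[mu]_z (acc_prob c Q m z * g z)%:E = J)%E.
Proof.
move=> cQ mg g0 hJ.
pose P := [pred A : {set I} | (A \subset Q) && (#|A| == c)].
have cardP : #|P| = 'C(#|Q|, c).
  by rewrite -cards_draws; apply: eq_card => A; rewrite !inE.
rewrite -(@ge0_integral_mean _ _ _ mu _ P
  (fun A z => (beats m A z)%:R * g z) J).
- by apply: eq_integral => z _; rewrite acc_probE cardP -mulr_suml mulrA.
- by rewrite cardP bin_gt0.
- by move=> A; exact: measurable_beatsM.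
- by move=> A z; rewrite mulr_ge0.
- by move=> A /andP[AQ /eqP]; exact: hJ.
Qed.

(** Each fixed [c]-subset gives the factor [c / (c + 1)], that is [1 - 1 / (c + 1)]. The complement
    is averaged directly, since the integral of [g] may be infinite and could not be subtracted. *)
Lemma integral_acc_prob_compl c m Q g : m \notin Q -> (c <= #|Q|)%N ->
  measurable_fun setT g -> (forall z, 0 <= g z) ->
  (forall a z, a \in Q -> g (permute (tperm a m) z) = g z) ->
  (\int[mu]_z ((1 - acc_prob c Q m z) * g z)%:E =
   (1 - c.+1%:R^-1)%:E * \int[mu]_z (g z)%:E)%E.
Proof.
move=> mQ cQ mg g0 gs.
pose P := [pred A : {set I} | (A \subset Q) && (#|A| == c)].
have cardP : #|P| = 'C(#|Q|, c).
  by rewrite -cards_draws; apply: eq_card => A; rewrite !inE.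
rewrite -(@ge0_integral_mean _ _ _ mu _ P
  (fun A z => (1 - (beats m A z)%:R) * g z)
  ((1 - c.+1%:R^-1)%:E * \int[mu]_z (g z)%:E)%E).
- apply: eq_integral => z _.
  rewrite acc_probE cardP -mulr_suml mulrA sumrB mulrBr.
  congr ((_ * _)%:E); rewrite sumr_const cardP mulVf // pnatr_eq0 -lt0n.
  by rewrite bin_gt0.
- by rewrite cardP bin_gt0.
- move=> A; apply: measurable_funM => //.
  by apply: measurable_funB => //; exact: measurable_beats.
- by move=> A z; rewrite mulr_ge0 // subr_ge0 lern1 leq_b1.
- move=> A /andP[/fintype.subsetP AQ /eqP cA].
  have mA : m \notin A by apply: contra mQ => /AQ.
  have gA a z : a \in A -> g (permute (tperm a m) z) = g z by move=> /AQ/gs.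
  rewrite integral_beats_compl // integral_beats // cA muleA -EFinM.
  have c0 : c.+1%:R != 0 :> R by rewrite pnatr_eq0.
  congr (_%:E * _)%E; apply: (mulIf c0).
  by rewrite mulfVK // mulrBl mulVf // mul1r -addn1 natrD addrK.
Qed.
End Exchangeable.

(** List each set followed by its complement and match the two lists position by position; equal
    cardinalities send the first block onto the first block. *)
Lemma exists_perm_imset (T : finType) (A B : {set T}) : #|A| = #|B| ->
  exists s : {perm T}, (s @: A)%SET = B.
Proof.
move=> AB; pose e (C : {set T}) := enum C ++ enum (~: C)%SET.
have mem_e C x : x \in e C by rewrite mem_cat !mem_enum inE orbN.
have uniq_e C : uniq (e C).
  rewrite cat_uniq !enum_uniq /= andbT; apply/hasPn => x.
  by rewrite !mem_enum inE.
have size_e C : size (e C) = #|T| by rewrite size_cat -!cardE cardsC.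
have f_inj : injective (fun x => nth x (e B) (index x (e A))).
  (* The default value of [nth] varies with the argument; it is made common, which is harmless since
     indices are in range. *)
  move=> x y; rewrite (set_nth_default y) ?size_e -?(size_e A) ?index_mem //.
  move=> /eqP; rewrite nth_uniq ?size_e -?(size_e A) ?index_mem //.
  by move=> /eqP /index_inj; apply.
exists (perm f_inj); apply/eqP; rewrite eqEcard card_imset ?AB ?leqnn ?andbT;
  last exact: perm_inj.
apply/fintype.subsetP => y /imsetP[x xA ->]; rewrite permE.
have ltx : (index x (enum A) < #|B|)%N by rewrite -AB cardE index_mem mem_enum.
rewrite index_cat mem_enum xA nth_cat -cardE ltx -mem_enum mem_nth //.
by rewrite -cardE.
Qed.

(** * Past entries, maxima and survival *)

Section PastAndMax.
Context (R : realType) (k n : nat).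
Notation I := ('I_k + 'I_n)%type.
Notation Z := (k.-tuple R * n.-tuple R)%type.
Implicit Types (z : Z) (a b m : I) (A B Q : {set I}) (s : {perm I}).
Implicit Types (g : Z -> R).

(** The step is a natural number rather than an ordinal, so that inductions can also reach
    [i = n]. *)
Definition past (i : nat) : {set I} :=
  [set a : I | if a is inr j then (j < i)%N else true]%SET.

Lemma pastS (i : 'I_n) : past i.+1 = (inr i |: past i)%SET.
Proof.
apply/setP => -[a|j]; rewrite !inE //= ltnS leq_eqVlt.
by congr (_ || _).
Qed.

Lemma notin_past (i : 'I_n) : inr i \notin past i.
Proof. by rewrite inE ltnn. Qed.

Lemma card_past (i : nat) : (i <= n)%N -> #|past i| = (k + i)%N.
Proof.
elim: i => [_|i IH ltin]; last first.
  rewrite (pastS (Ordinal ltin)) cardsU1 (notin_past (Ordinal ltin)) /=.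
  by rewrite (IH (ltnW ltin)) addnS.
rewrite addn0 -[RHS]card_ord -(card_imset _ (@inl_inj 'I_k 'I_n)).
apply: eq_card => -[a|j]; rewrite !inE.
  by rewrite imset_f.
by rewrite ltn0; apply/esym/imsetP => -[].
Qed.

(** The floor 0 agrees with [max_value] and makes the function nonnegative everywhere, not only on
    nonnegative entries. *)
Definition max_entry B z : R := \big[Num.max/0]_(b in B) entry z b.

Lemma max_entry_ge0 B z : 0 <= max_entry B z.
Proof. by apply/bigmax_geP; left. Qed.

Lemma measurable_max_entry B : measurable_fun setT (max_entry B).
Proof.
rewrite (_ : max_entry B =
  fun z => \big[Num.max/0]_(b <- enum B) entry z b); last first.
  by apply/funext => z; rewrite big_enum.
elim: (enum B) => [|b e IH].
  by rewrite (_ : (fun _ => _) = cst 0) //; apply/funext => z; rewrite big_nil.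
rewrite (_ : (fun _ => _) =
    (fun z : Z => entry z b) \max
    (fun z : Z => \big[Num.max/0]_(b <- e) entry z b)).
  by apply: measurable_maxr => //; exact: measurable_entry.
by apply/funext => z; rewrite big_cons.
Qed.

Lemma max_entry_permute B s z :
  max_entry B (permute s z) = max_entry (s @: B)%SET z.
Proof.
apply/eqP; rewrite eq_le; apply/andP; split; apply: bigmax_le => [|b bB];
    rewrite ?max_entry_ge0 //.
  by rewrite entry_permute le_bigmax_cond // imset_f.
case/imsetP: bB => a aB ->; rewrite -entry_permute.
exact: (le_bigmax_cond _ (entry (permute s z))).
Qed.

Lemma max_entry_beats m A z : beats m A z ->
  max_entry (m |: A)%SET z = Num.max (entry z m) 0.
Proof.
move=> /beatsP mA; apply/eqP; rewrite eq_le; apply/andP; split.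
  apply: bigmax_le => [|b]; first by rewrite le_max lexx orbT.
  by rewrite !inE le_max => /predU1P[->|/mA/ltW->]; rewrite ?lexx.
by rewrite ge_max max_entry_ge0 andbT le_bigmax_cond ?setU11.
Qed.

Variable mu : {measure set Z -> \bar R}.
Hypothesis mu_permute : forall s (f : Z -> R), measurable_fun setT f ->
  (forall z, 0 <= f z) ->
  (\int[mu]_z (f (permute s z))%:E = \int[mu]_z (f z)%:E)%E.
Hypothesis mu_ties : forall a b, a != b ->
  mu [set z | entry z a = entry z b] = 0%E.

(** A permutation carries [A] onto [B], so the mean maximum depends only on the number of entries;
    any [n] entries can stand in for the [n] values. *)
Lemma integral_max_entry A B : #|A| = #|B| ->
  (\int[mu]_z (max_entry A z)%:E = \int[mu]_z (max_entry B z)%:E)%E.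
Proof.
move=> /exists_perm_imset[s <-].
under [RHS]eq_integral do rewrite -max_entry_permute.
rewrite mu_permute //; first exact: measurable_max_entry.
exact: max_entry_ge0.
Qed.

Lemma max_entry_tperm B a b z : a \in B -> b \in B ->
  max_entry B (permute (tperm a b) z) = max_entry B z.
Proof.
move=> aB bB; rewrite max_entry_permute; congr max_entry.
apply/eqP; rewrite eqEcard card_imset ?leqnn ?andbT; last exact: perm_inj.
by apply/fintype.subsetP => _ /imsetP[x xB ->]; case: tpermP.
Qed.

(** When [m] beats a [c]-subset [A], the payoff is the maximum over [m |: A], which is symmetric in
    these [c + 1] entries; [integral_beats] then extracts the factor. Truncating the payoff at 0
    keeps the integrand nonnegative. *)
Lemma integral_acc_prob_max c m Q B : m \notin Q -> (c <= #|Q|)%N ->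
  #|B| = c.+1 ->
  (\int[mu]_z (acc_prob c Q m z * Num.max (entry z m) 0)%:E =
   (c.+1%:R^-1)%:E * \int[mu]_z (max_entry B z)%:E)%E.
Proof.
move=> mQ cQ cB; apply: integral_acc_prob => //.
- by apply: measurable_maxr => //; exact: measurable_entry.
- by move=> z; rewrite le_max lexx orbT.
- move=> A /fintype.subsetP AQ cA.
  have mA : m \notin A by apply: contra mQ => /AQ.
  rewrite -(@integral_max_entry (m |: A)%SET); last by rewrite cardsU1 mA cA cB.
  rewrite -cA -(integral_beats mu_permute mu_ties (m := m)) //.
  + apply: eq_integral => z _.
    have [/max_entry_beats ->//|_] := boolP (beats m A z).
    by rewrite !mul0r.
  + exact: measurable_max_entry.
  + exact: max_entry_ge0.
  + by move=> a z aA; apply: max_entry_tperm; rewrite ?setU11 // inE aA orbT.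
Qed.

Definition survival c (i : nat) z : R :=
  \prod_(j < n | (j < i)%N) (1 - acc_prob c (past j) (inr j) z).

(* A function symmetric in the past entries does not see whether the rule has
   already stopped. *)
Lemma integral_survival c i g : (c <= k)%N -> (i <= n)%N ->
  measurable_fun setT g -> (forall z, 0 <= g z) ->
  (forall a b z, a \in past i -> b \in past i ->
    g (permute (tperm a b) z) = g z) ->
  (\int[mu]_z (survival c i z * g z)%:E =
   ((1 - c.+1%:R^-1) ^+ i)%:E * \int[mu]_z (g z)%:E)%E.
Proof.
move=> ck; elim: i g => [|i IH] g lein mg g0 gs.
  rewrite expr0 mul1e; apply: eq_integral => z _.
  by rewrite /survival big_pred0 ?mul1r.
pose i' := Ordinal lein; have pE : past i.+1 = _ := pastS i'.
have sub_past a : a \in past i -> a \in past i.+1 by rewrite pE; exact: setU1r.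
(* The last survival factor is absorbed into [g]: the product is still symmetric in [past i], so the
   induction hypothesis applies. The factor is then integrated out, as [g] is also symmetric under
   exchanges with the current entry, which lies in [past i.+1]. *)
rewrite exprSr EFinM -muleA -(integral_acc_prob_compl mu_permute mu_ties
  (m := inr i') (Q := past i) (c := c)) //.
- rewrite -IH //.
  + apply: eq_integral => z _; rewrite mulrA; congr ((_ * _)%:E).
    rewrite /survival (bigD1 i') //= mulrC; congr (_ * _).
    by apply: eq_bigl => j; rewrite ltnS leq_eqVlt -val_eqE /=; case: ltngtP.
  + exact: ltnW.
  + apply: measurable_funM => //; apply: measurable_funB => //.
    exact: measurable_acc_prob.
  + move=> z; rewrite mulr_ge0 // subr_ge0.
    by have /andP[] := acc_prob_itv c (past i) (inr i') z.
  + move=> a b z ai bi; rewrite gs ?sub_past // acc_prob_permute //.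
      by rewrite tpermD //; [move: ai|move: bi]; apply: contraTneq => ->;
        exact: (notin_past i').
    by move=> x; case: tpermP => // ->; rewrite ai bi.
- exact: (notin_past i').
- rewrite (card_past (ltnW lein)); exact: leq_trans ck (leq_addr _ _).
- move=> a z ai; apply: gs; first exact: sub_past.
  by rewrite pE setU11.
Qed.

(** Acceptance times payoff is symmetric in the past, because transpositions of past entries fix the
    current index; hence survival factors out. *)
Lemma integral_survival_acc_prob_max c (i : 'I_n) B :
  (c <= k)%N -> #|B| = c.+1 ->
  (\int[mu]_z (survival c i z * acc_prob c (past i) (inr i) z *
     Num.max (entry z (inr i)) 0)%:E =
   ((1 - c.+1%:R^-1) ^+ i * c.+1%:R^-1)%:E *
   \int[mu]_z (max_entry B z)%:E)%E.
Proof.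
move=> ck cB.
under eq_integral do rewrite -mulrA.
have m_max : measurable_fun setT (fun z => Num.max (entry z (inr i)) 0).
  by apply: measurable_maxr => //; exact: measurable_entry.
rewrite integral_survival //.
- rewrite EFinM -muleA (@integral_acc_prob_max c _ _ B) // ?notin_past //.
  by rewrite (card_past (ltnW (ltn_ord i))); exact: leq_trans ck (leq_addr _ _).
- exact: ltnW.
- by apply: measurable_funM => //; exact: measurable_acc_prob.
- move=> z; rewrite mulr_ge0 // ?le_max ?lexx ?orbT //.
  by have /andP[] := acc_prob_itv c (past i) (inr i) z.
- move=> a b z ai bi.
  have fix_i : tperm a b (inr i) = inr i.
    by rewrite tpermD //; [move: ai|move: bi]; apply: contraTneq => ->;
      exact: (notin_past i).
  rewrite entry_permute fix_i acc_prob_permute //.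
  by move=> x; case: tpermP => // ->; rewrite ai bi.
Qed.
End PastAndMax.

(** * The law of the entries *)

Section LawOfEntries.
Context (R : realType) (k n : nat).
Notation I := ('I_k + 'I_n)%type.
Notation Z := (k.-tuple R * n.-tuple R)%type.

Definition box (B : I -> set R) : set Z := [set z | forall a, B a (entry z a)].

Lemma measurable_box (B : I -> set R) :
  (forall a, measurable (B a)) -> measurable (box B).
Proof.
move=> mB.
rewrite (_ : box B = \bigcap_(a in [set: I]) (fun z => entry z a) @^-1` B a).
  apply: fin_bigcap_measurable => // a _.
  by rewrite -[X in measurable X]setTI; apply: measurable_entry.
by apply/seteqP; split => z h a *; exact: h.
Qed.

Let boxes : set (set Z) :=
  [set A | exists2 B, forall a, measurable (B a) & A = box B].

(** For the nontrivial inclusion, the identity is measurable from the sigma-algebra of boxes because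
    each entry is: its preimages are boxes with all other sides full. *)
Lemma measurable_generated_by_boxes : measurable = <<s boxes >>.
Proof.
apply/seteqP; split => A; last first.
  apply: smallest_sub; first exact: sigma_algebra_measurable.
  by move=> _ [B mB ->]; exact: measurable_box.
move=> mA; pose f : g_sigma_algebraType boxes -> Z := id.
suff mf : measurable_fun setT f by have := mf measurableT A mA; rewrite setTI.
apply: measurable_fun_entries => a _ C mC; rewrite setTI.
apply: sub_sigma_algebra; exists (fun b => if b == a then C else setT).
  by move=> b; case: ifP.
apply/seteqP; split => z /= => [Ca b|/(_ a)]; last by rewrite eqxx.
by case: eqP => // ->.
Qed.

(** Boxes generate the sigma-algebra, are stable under intersection and include the whole space, so
    uniqueness of measures applies. *)
Lemma eq_measure_box (m1 m2 : {measure set Z -> \bar R}) :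
  (m1 setT < +oo)%E ->
  (forall B, (forall a, measurable (B a)) -> m1 (box B) = m2 (box B)) ->
  forall A, measurable A -> m1 A = m2 A.
Proof.
move=> m1fin m12; have boxT : box (fun=> setT) = setT.
  by apply/seteqP; split.
apply: (measure_unique boxes (fun=> setT)) => //.
- exact: measurable_generated_by_boxes.
- move=> _ _ [B mB ->] [C mC ->]; exists (fun a => B a `&` C a).
    by move=> a; exact: measurableI.
  apply/seteqP; split => z /= => [[hB hC] a|h]; first by split.
  by split=> a; have [] := h a.
- by move=> _; exists (fun=> setT).
- by rewrite bigcup_const.
- by move=> _ [B mB ->]; exact: m12.
Qed.

End LawOfEntries.

(** As [y] increases to [x], the masses of []-oo, y]] tend to that of []-oo, x]] by continuity, yet
    never exceed that of []-oo, x[]; nothing is left for the point. *)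
Lemma no_atom (R : realType) (F : probability R R) (x : R) :
  continuous_distribution F -> F [set x] = 0%E.
Proof.
move=> [_ Fcont].
have cvgF : F `]-oo, y]%classic @[y --> x^'-] --> F `]-oo, x]%classic.
  exact/cvg_at_left_filter/Fcont.
have le_F : (F `]-oo, x]%classic <= F `]-oo, x[%classic)%E.
  apply: (lee_cvg_to cvgF (cvg_cst _)); near=> y.
  apply: le_measure; rewrite ?inE //.
  apply: subset_itvl; rewrite bnd_simp.
  by near: y; exact: nbhs_left_lt.
have finF (A : set R) : measurable A -> F A \is a fin_num.
  exact: fin_num_measure.
have eqF : F `]-oo, x]%classic = (F `]-oo, x[%classic + F [set x])%E.
  rewrite -measureU //; first by rewrite setUitv1 //.
  apply/seteqP; split => // y [/=]. 
  by rewrite in_itv /= => -[/[swap] ->]; rewrite ltxx.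
apply/eqP; rewrite eq_le measure_ge0 andbT.
by move: le_F; rewrite eqF addeC -leeBrDr ?finF // subee ?finF.
Unshelve. all: by end_near. Qed.

(** * From indicators to nonnegative functions under a weight *)

Section WeightedIntegral.
Context d d' (T : measurableType d) (U : measurableType d') (R : realType).
Variables (mu : {measure set T -> \bar R}) (Y : T -> U).
Hypothesis mY : measurable_fun setT Y.
Implicit Types (h : T -> R) (f : U -> R).

Import HBNNSimple.

(** Monotone convergence along simple approximations of [f] expresses the weighted integral through
    weighted integrals of indicators alone. *)
Lemma integral_weight_lim f (mf : measurable_fun setT (EFin \o f)) h :
  (forall u, 0 <= f u) -> measurable_fun setT h -> (forall t, 0 <= h t) ->
  (\int[mu]_t (h t * f (Y t))%:E =
   limn (fun i => \sum_(r \in range (nnsfun_approx measurableT mf i))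
     (r%:E * \int[mu]_t
       (h t * \1_(nnsfun_approx measurableT mf i @^-1` [set r]) (Y t))%:E)))%E.
Proof.
move=> f0 mh h0; pose f_ := nnsfun_approx measurableT mf.
have mhY (g : {nnsfun U >-> R}) : measurable_fun setT (fun t => h t * g (Y t)).
  apply: measurable_funM => //; exact: (measurableT_comp (measurable_funP g)).
transitivity (limn (fun i => \int[mu]_t (h t * f_ i (Y t))%:E))%E.
  rewrite -monotone_convergence //.
  - apply: eq_integral => t _; apply/esym/cvg_lim => //.
    rewrite EFinM; under eq_fun do rewrite EFinM.
    apply: cvgeZl => //; apply: (cvg_nnsfun_approx measurableT mf) => // u _.
    by rewrite lee_fin.
  - by move=> i; apply/measurable_EFinP; exact: mhY.
  - by move=> i t _; rewrite lee_fin mulr_ge0.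
  - move=> t _ i j ij; rewrite lee_fin ler_wpM2l //.
    exact/lefP/nd_nnsfun_approx.
congr (limn _); apply/funext => i; rewrite -/(f_ i).
transitivity (\int[mu]_t \sum_(r \in range (f_ i))
    (r%:E * (h t * \1_(f_ i @^-1` [set r]) (Y t))%:E))%E.
  apply: eq_integral => t _; rewrite fimfunE.
  rewrite !fsbig_finite //= mulr_sumr -sumEFin; apply: eq_bigr => r _.
  by rewrite -EFinM mulrCA.
have m1 r : measurable_fun setT (fun t => h t * \1_(f_ i @^-1` [set r]) (Y t)).
  apply: measurable_funM => //.
  by apply: (measurableT_comp _ mY); exact: measurable_indic.
have ge01 r t : (0 <= r%:E * (h t * \1_(f_ i @^-1` [set r]) (Y t))%:E)%E.
  rewrite -EFinM mulrCA lee_fin mulr_ge0 //.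
  by have := nnfun_muleindic_ge0 (f_ i) r (Y t); rewrite lee_fin.
rewrite ge0_integral_fsum //; last first.
  by move=> r; apply: measurable_funeM; apply/measurable_EFinP.
apply: eq_fsbigr => r /[!inE] -[u _ <-].
rewrite ge0_integralZl //; first exact/measurable_EFinP.
  by move=> t _; rewrite lee_fin mulr_ge0.
by rewrite lee_fin.
Qed.

(* Extends the identity defining the law of a stopping time from events to
   nonnegative functions. *)
Lemma eq_integral_weight h1 h2 f :
  measurable_fun setT h1 -> (forall t, 0 <= h1 t) ->
  measurable_fun setT h2 -> (forall t, 0 <= h2 t) ->
  measurable_fun setT f -> (forall u, 0 <= f u) ->
  (forall A, measurable A -> \int[mu]_t (h1 t * \1_A (Y t))%:E =
     \int[mu]_t (h2 t * \1_A (Y t))%:E)%E ->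
  (\int[mu]_t (h1 t * f (Y t))%:E = \int[mu]_t (h2 t * f (Y t))%:E)%E.
Proof.
move=> mh1 h10 mh2 h20 /measurable_EFinP mf f0 h12.
rewrite !(integral_weight_lim mf) //; congr (limn _); apply/funext => i.
by apply: eq_fsbigr => r _; rewrite h12.
Qed.

End WeightedIntegral.

(** * Joint law of i.i.d. samples and values *)

Section JointLaw.
Context d (Omega : measurableType d) (R : realType) (P : probability Omega R).
Context (F : probability R R) (k n : nat).
Context (S : 'I_k -> {RV P >-> R}) (X : 'I_n -> {RV P >-> R}).
Notation I := ('I_k + 'I_n)%type.
Notation Y := (joint_family S X).
Notation J := (joint_vector S X).

Lemma entry_joint_vector w a : entry (J w) a = Y a w.
Proof. by case: a => a; rewrite /= tnth_mktuple. Qed.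

Lemma measurable_joint_vector : measurable_fun setT J.
Proof.
apply: measurable_fun_entries => a.
by under eq_fun do rewrite entry_joint_vector; exact: measurable_funP.
Qed.

HB.instance Definition _ :=
  isMeasurableFun.Build _ _ _ _ J measurable_joint_vector.

Definition joint_law : probability (k.-tuple R * n.-tuple R)%type R :=
  distribution P J.

Lemma integral_joint_law (f : k.-tuple R * n.-tuple R -> R) :
  measurable_fun setT f -> (forall z, 0 <= f z) ->
  (\int[joint_law]_z (f z)%:E = \int[P]_w (f (J w))%:E)%E.
Proof.
move=> mf f0; rewrite ge0_integral_pushforward ?preimage_setT //.
- exact/measurable_EFinP.
- by move=> z _; rewrite lee_fin.
Qed.

HB.instance Definition _ s := isMeasurableFun.Build _ _ _ _
  (@permute R k n s) (measurable_permute s).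

Hypothesis iidY : iid F Y.

Lemma joint_law_box (B : I -> set R) : (forall a, measurable (B a)) ->
  joint_law (box B) = (\prod_(a : I) F (B a))%E.
Proof.
move=> mB; have [ind law] := iidY.
rewrite (eq_bigr (fun a => P (Y a @^-1` B a))); last first.
  by move=> a _; rewrite -(law a).
transitivity (\prod_(a in [set: I]%SET) P (Y a @^-1` B a))%E; last first.
  by apply: eq_bigl => a; rewrite inE.
rewrite -ind // /joint_law /distribution /pushforward.
congr (P _); apply/seteqP; split => w /=.
  by move=> h a _ /=; rewrite -entry_joint_vector; exact: h.
by move=> h a; rewrite entry_joint_vector; apply: h; rewrite /= inE.
Qed.

(** Boxes determine both laws, and on a box both are the product of the [F]-masses of its sides,
    taken in different orders. *)
Lemma joint_law_permute s (f : k.-tuple R * n.-tuple R -> R) :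
  measurable_fun setT f -> (forall z, 0 <= f z) ->
  (\int[joint_law]_z (f (permute s z))%:E = \int[joint_law]_z (f z)%:E)%E.
Proof.
move=> mf f0.
transitivity (\int[distribution joint_law (permute s)]_z (f z)%:E)%E.
  rewrite [RHS]ge0_integral_pushforward ?preimage_setT //.
  - exact/measurable_EFinP.
  - by move=> z _; rewrite lee_fin.
apply: eq_measure_integral => A mA _.
apply: eq_measure_box mA.
  exact: le_lt_trans (probability_le1 (distribution joint_law (permute s))
    measurableT) (ltry _).
move=> B mB; transitivity (joint_law (box (fun a => B (s^-1%g a)))); last first.
  rewrite joint_law_box //; apply/esym; rewrite [LHS]joint_law_box //.
  by rewrite (reindex_inj (@perm_inj _ s^-1%g)).
rewrite -[LHS]/(joint_law (permute s @^-1` box B)); congr (joint_law _).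
apply/seteqP; split => z h a /=.
  by have := h (s^-1%g a); rewrite entry_permute permKV.
by have := h (s a); rewrite entry_permute permK.
Qed.

(** The pair of entries has law [F] times [F], and every section of the diagonal is a single point,
    null by [no_atom]. *)
Lemma joint_law_ties a b : continuous_distribution F -> a != b ->
  joint_law [set z | entry z a = entry z b] = 0%E.
Proof.
move=> Fcont ab; have [ind law] := iidY.
have mYab : measurable_fun setT (fun w => (Y a w, Y b w)).
  by apply: measurable_fun_pair; exact: measurable_funP.
pose Yab : {mfun Omega >-> (R * R)%type} := mfun_Sub (mem_set mYab).
have mdiag : measurable [set u : R * R | u.1 = u.2].
  rewrite (_ : mkset _ = (fun u : R * R => u.1 == u.2) @^-1` [set true]).
    by rewrite -[X in measurable X]setTI; apply: measurable_fun_eqr.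
  by apply/seteqP; split => u /= /eqP.
transitivity (distribution P Yab [set u | u.1 = u.2]).
  by rewrite /joint_law /distribution /pushforward; congr (P _);
    apply/seteqP; split => w /=; rewrite !entry_joint_vector.
rewrite -(@product_measure_unique _ _ _ _ _ F F) //.
  rewrite /product_measure1 integral0_eq // => x _ /=.
  rewrite (_ : xsection _ _ = [set x]) ?no_atom //.
  by apply/seteqP; split => y; rewrite /xsection /= inE.
move=> A B mA mB; transitivity (F A * F B)%E => //.
rewrite -(law a) // -(law b) // -[RHS]/(P (Y a @^-1` A) * P (Y b @^-1` B))%E.
(* Independence is applied to the two indices only; since [a != b], one family of sets can assign
   [A] to [a] and [B] to [b]. *)
have := ind [set a; b]%SET (fun c => if c == a then A else B).
rewrite big_setU1 ?inE //= big_set1 eqxx eq_sym (negPf ab) => <-; last first.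
  by move=> c; case: ifP.
congr (P _); apply/seteqP; split => w /=.
  by move=> [Aw Bw] c /set2P[->|->] /=; rewrite ?eqxx // eq_sym (negPf ab).
move=> h; split.
  by have /= := h a (set21 a b); rewrite eqxx.
by have /= := h b (set22 a b); rewrite eq_sym (negPf ab).
Qed.

Lemma joint_law_ge0 : continuous_distribution F ->
  {ae joint_law, forall z, forall a, 0 <= entry z a}.
Proof.
move=> [F0 _]; have [_ law] := iidY; apply: filter_forall => a.
exists ((fun z => entry z a) @^-1` `]-oo, 0[%classic); split.
- by rewrite -[X in measurable X]setTI; apply: measurable_entry.
- transitivity (distribution P (Y a) `]-oo, 0[%classic).
    rewrite -[RHS]/(P (Y a @^-1` _)) -[LHS]/(P (J @^-1` _)); congr (P _).
    by apply/seteqP; split => w /=; rewrite entry_joint_vector.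
  by rewrite law // -setCitvr probability_setC // F0 subee.
- by move=> z /=; rewrite in_itv /= => /negP; rewrite ltNge.
Qed.

End JointLaw.

(** * The rule *)

Section FreshSampleRule.
Context (R : realType) (k n c : nat).
Notation Z := (k.-tuple R * n.-tuple R)%type.
Implicit Types (z : Z).

(** The parameter [c] is the size of the random subset. Step [i] sees [i.+1] values, so the current
    one has index [ord_max]. The definition is transparent because its function is unfolded
    later. *)
Definition fresh_sample_rule : stopping_rule R k n.
Proof.
refine (@StoppingRule R k n
  (fun i => acc_prob c (past k i.+1 i) (inr ord_max)) _ _).
- by move=> i; apply: measurable_funTS; exact: measurable_acc_prob.
- by move=> i z _; exact: acc_prob_itv.
Defined.

(** The truncated indices embed into the full ones; [emb] preserves entries, sends the last value to
    [i] and reaches every index of the past, so the counts agree. *)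
Lemma acc_prob_values_upto (i : 'I_n) z :
  acc_prob c (past k i.+1 i) (inr ord_max) (z.1, values_upto i z.2) =
  acc_prob c (past k n i) (inr i) z.
Proof.
pose emb (a : 'I_k + 'I_i.+1) : 'I_k + 'I_n :=
  match a with inl j => inl j | inr j => inr (widen_ord (ltn_ord i) j) end.
have emb_inj : injective emb.
  by move=> [a|a] [b|b] //= [] => [->|ab] //; congr inr; apply/val_inj.
have entryE a : entry (z.1, values_upto i z.2) a = entry z (emb a).
  by case: a => a //=; rewrite tnth_mktuple.
have embi : emb (inr ord_max) = inr i by congr inr; apply/val_inj.
rewrite /acc_prob !card_past // ?(ltnW (ltn_ord i)) //.
rewrite -(card_imset _ emb_inj); congr ('C(_, c)%:R / _).
apply: eq_card => b; apply/imsetP/idP => [[a + ->]|].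
  by rewrite !inE !entryE embi; case: a.
case: b => [b|b]; rewrite !inE => /andP[lt_bi ltE].
  by exists (inl b) => //; rewrite !inE !entryE embi.
exists (inr (Ordinal (ltnW lt_bi : b < i.+1)%N)).
  rewrite !inE !entryE embi lt_bi /emb.
  by rewrite (_ : widen_ord _ _ = b) //; exact/val_inj.
by congr inr; apply/val_inj.
Qed.

Lemma stop_prob_fresh_sample_rule (i : 'I_n) z :
  stop_prob fresh_sample_rule i z =
  survival c i z * acc_prob c (past k n i) (inr i) z.
Proof.
rewrite /stop_prob /= acc_prob_values_upto; congr (_ * _).
by apply: eq_bigr => j _; rewrite acc_prob_values_upto.
Qed.

Lemma measurable_stop_prob (i : 'I_n) :
  measurable_fun setT (stop_prob fresh_sample_rule i).
Proof.
rewrite (_ : stop_prob _ _ = fun z =>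
    survival c i z * acc_prob c (past k n i) (inr i) z); last first.
  by apply/funext => z; exact: stop_prob_fresh_sample_rule.
apply: measurable_funM; last exact: measurable_acc_prob.
rewrite (_ : survival c i = fun z =>
    \prod_(j <- enum 'I_n)
      if (j < i)%N then 1 - acc_prob c (past k n j) (inr j) z else 1).
  apply: measurable_prod => j _; case: (j < i)%N => //.
  by apply: measurable_funB => //; exact: measurable_acc_prob.
by apply/funext => z; rewrite big_enum /survival big_mkcond.
Qed.

Lemma stop_prob_ge0 (i : 'I_n) z : 0 <= stop_prob fresh_sample_rule i z.
Proof.
rewrite stop_prob_fresh_sample_rule mulr_ge0 //; last first.
  by have /andP[] := acc_prob_itv c (past k n i) (inr i) z.
apply: prodr_ge0 => j _; rewrite subr_ge0.
by have /andP[] := acc_prob_itv c (past k n j) (inr j) z.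
Qed.

End FreshSampleRule.

Lemma nneg_inputs_box (R : realType) (k n : nat) :
  nneg_inputs R k n = box (fun=> `[0, +oo[%classic).
Proof.
apply/seteqP; split => z /=.
  by move=> [h1 h2] [a|a] /=; rewrite in_itv /= andbT; [exact: h1|exact: h2].
move=> h; split => j; [have := h (inl j)|have := h (inr j)];
  by rewrite /= in_itv /= andbT.
Qed.

(** * Expected stopped value *)

Section Stopping.
Context d (Omega : measurableType d) (R : realType) (P : probability Omega R).
Context (F : probability R R) (k n c : nat).
Context (S : 'I_k -> {RV P >-> R}) (X : 'I_n -> {RV P >-> R}).
Context (tau : Omega -> option 'I_n).
Notation J := (joint_vector S X).
Notation r := (@fresh_sample_rule R k n c).
Hypothesis Fcont : continuous_distribution F.
Hypothesis iidY : iid F (joint_family S X).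
Hypothesis htau : is_stopping_time S X r tau.

Let mtau i : measurable (tau @^-1` [set Some i]).
Proof. by have [] := htau. Qed.

Let mJ : measurable_fun setT J := measurable_joint_vector S X.

Let mstop i : measurable_fun setT (fun w => stop_prob r i (J w)).
Proof. exact: (measurableT_comp (@measurable_stop_prob R k n c i) mJ). Qed.

Lemma ae_values_ge0 : {ae P, forall w, nneg_inputs R k n (J w)}.
Proof.
have [N [mN N0 subN]] := joint_law_ge0 iidY Fcont.
exists (J @^-1` N); split => //.
  by rewrite -[X in measurable X]setTI; exact: mJ.
move=> w /=; apply: contra_notP => JN; rewrite nneg_inputs_box => a /=.
rewrite in_itv /= andbT; apply: contra_notT JN => /negP h.
by apply: subN => /(_ a).
Qed.

(** The law of [tau] is prescribed only on events within nonnegative inputs; cutting [A] down to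
    these changes the integrands on a null set only. *)
Lemma integral_indic_stop i A : measurable A ->
  (\int[P]_w (\1_(tau @^-1` [set Some i]) w * \1_A (J w))%:E =
   \int[P]_w (stop_prob r i (J w) * \1_A (J w))%:E)%E.
Proof.
move=> mA; pose A' := A `&` nneg_inputs R k n.
have mA' : measurable A'.
  by apply: measurableI => //; rewrite nneg_inputs_box; exact: measurable_box.
have drop (h : Omega -> R) : measurable_fun setT h ->
    (\int[P]_w (h w * \1_A (J w))%:E = \int[P]_w (h w * \1_A' (J w))%:E)%E.
  move=> mh; have m1 B : measurable B ->
      measurable_fun setT (fun w => (h w * \1_B (J w))%:E).
    move=> mB; apply/measurable_EFinP; apply: measurable_funM => //.
    by apply: (measurableT_comp _ mJ); exact: measurable_indic.
  apply: ae_eq_integral => //; [exact: m1|exact: m1|].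
  apply: filterS ae_values_ge0 => w Jw _; congr ((_ * _)%:E).
  by rewrite /A' indicI /= (@indicE _ R (nneg_inputs _ _ _)) mem_set // mulr1.
rewrite !drop //; have [_ /(_ i A' mA' (@subIsetr _ _ _))] := htau.
have mJA : measurable (J @^-1` A').
  by rewrite -[X in measurable X]setTI; exact: mJ.
rewrite [in RHS]integral_mkcond => eqP.
transitivity (P (tau @^-1` [set Some i] `&` J @^-1` A')).
  rewrite -[X in P X]setIT -integral_indic //; last exact: measurableI.
  by apply: eq_integral => w _; rewrite indicI.
rewrite eqP; apply: eq_integral => w _; rewrite patchE indicE.
rewrite -[J w \in A']/(w \in J @^-1` A').
by case: ifP => _; rewrite ?mulr1 ?mulr0.
Qed.

(** The stopped value is a sum of values weighted by stopping indicators; [eq_integral_weight]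
    replaces each indicator by its conditional probability, once truncation at 0 has made the values
    nonnegative. *)
Lemma integral_stopped_value :
  (\int[P]_w (stopped_value X tau w)%:E =
   \sum_(i < n) \int[P]_w
     (stop_prob r i (J w) * Num.max (X i w) 0)%:E)%E.
Proof.
have m1 i : measurable_fun setT (\1_(tau @^-1` [set Some i]) : Omega -> R).
  exact: measurable_indic.
have m_max (i : 'I_n) : measurable_fun setT (fun z : k.-tuple R * n.-tuple R =>
    Num.max (entry z (inr i)) 0).
  by apply: measurable_maxr => //; exact: measurable_entry.
have max_ge0 x : 0 <= Num.max x 0 :> R by rewrite le_max lexx orbT.
transitivity (\sum_(i < n) \int[P]_w
    (\1_(tau @^-1` [set Some i]) w * Num.max (X i w) 0)%:E)%E; last first.
  apply: eq_bigr => i _.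
  pose f (z : k.-tuple R * n.-tuple R) := Num.max (entry z (inr i)) 0.
  have fJ w : Num.max (X i w) 0 = f (J w) by rewrite /f entry_joint_vector.
  under eq_integral do rewrite fJ.
  under [RHS]eq_integral do rewrite fJ.
  apply: eq_integral_weight => //.
  - by move=> w; exact: stop_prob_ge0.
  - exact: m_max.
  - by move=> z; exact: max_ge0.
  - exact: integral_indic_stop.
(* If [tau w] is [None], all indicators vanish, matching the value 0 for never stopping. *)
have sumE w : stopped_value X tau w =
    \sum_(i < n) \1_(tau @^-1` [set Some i]) w * X i w.
  rewrite /stopped_value; case tauw: (tau w) => [i|].
    rewrite (bigD1 i) //= big1 => [|j ji]; rewrite indicE.
      by rewrite mem_set //= mul1r addr0.
    by rewrite memNset ?mul0r //= tauw => -[ij]; rewrite ij eqxx in ji.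
  by rewrite big1 // => j _; rewrite indicE memNset ?mul0r //= tauw.
rewrite -ge0_integral_sum //=; first last.
- by move=> i w _; rewrite lee_fin mulr_ge0.
- move=> i; apply/measurable_EFinP; apply: measurable_funM => //.
  by apply: measurable_maxr.
apply: ae_eq_integral => //.
- apply/measurable_EFinP; rewrite (funext sumE).
  by apply: measurable_sum => i; apply: measurable_funM.
- apply: emeasurable_sum => i; apply/measurable_EFinP.
  by apply: measurable_funM => //; apply: measurable_maxr.
apply: filterS ae_values_ge0 => w [_ Xw] _; rewrite sumEFin sumE; congr (_%:E).
apply: eq_bigr => i _; congr (_ * _); apply/esym/max_idPl.
by have := Xw i; rewrite /= tnth_mktuple.
Qed.

Lemma max_value_entry w :
  max_value X w = max_entry (inr @: [set: 'I_n])%SET (J w).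
Proof.
apply/eqP; rewrite eq_le; apply/andP; split; apply: bigmax_le => [|a aA].
- exact: max_entry_ge0.
- rewrite -[X a w]/(joint_family S X (inr a) w) -entry_joint_vector.
  by apply: (le_bigmax_cond _ (entry (J w))); exact: imset_f.
- by apply/bigmax_geP; left.
- case/imsetP: aA => i _ ->; rewrite entry_joint_vector.
  exact: (le_bigmax_cond _ (fun i => X i w)).
Qed.

(** The contributions of the steps form a geometric series. The identity lives in the extended
    reals: the mean maximum may be infinite, so it is factored out using nonnegative
    coefficients. *)
Lemma expectation_stopped_value : n = c.+1 -> (c <= k)%N ->
  ('E_P[stopped_value X tau] =
   (1 - (1 - n%:R^-1) ^+ n)%:E * 'E_P[max_value X])%E.
Proof.
move=> nc ck; rewrite unlock integral_stopped_value.
pose V : {set 'I_k + 'I_n} := (inr @: [set: 'I_n])%SET.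
have cV : #|V| = c.+1.
  by rewrite card_imset; [rewrite cardsT card_ord|exact: inr_inj].
have -> : (\int[P]_w (max_value X w)%:E =
    \int[joint_law S X]_z (max_entry V z)%:E)%E.
  rewrite integral_joint_law.
  - by apply: eq_integral => w _; rewrite max_value_entry.
  - exact: measurable_max_entry.
  - exact: max_entry_ge0.
have int_i (i : 'I_n) :
    (\int[P]_w (stop_prob r i (J w) * Num.max (X i w) 0)%:E =
     ((1 - n%:R^-1) ^+ i * n%:R^-1)%:E *
     \int[joint_law S X]_z (max_entry V z)%:E)%E.
  have := integral_survival_acc_prob_max (joint_law_permute iidY)
    (fun a b => @joint_law_ties _ _ _ _ _ _ _ _ _ iidY a b Fcont) i ck cV.
  rewrite -nc => <-.
  under [RHS]eq_integral do rewrite -stop_prob_fresh_sample_rule.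
  rewrite integral_joint_law.
  - by apply: eq_integral => w _; rewrite entry_joint_vector.
  - apply: measurable_funM; first exact: measurable_stop_prob.
    by apply: measurable_maxr => //; exact: measurable_entry.
  - by move=> z; rewrite mulr_ge0 ?stop_prob_ge0 // le_max lexx orbT.
rewrite (eq_bigr _ (fun i _ => int_i i)) -ge0_sume_distrl; last first.
  move=> i _; rewrite lee_fin mulr_ge0 // exprn_ge0 // subr_ge0.
  by rewrite invf_le1 ?ler1n ?ltr0n nc.
rewrite sumEFin -mulr_suml; congr (_%:E * _)%E.
(* With [q = 1 - 1/n], this is [1 - q^n = (1 - q) (1 + q + ... + q^(n-1))], where [1 - q = 1/n]. *)
by rewrite -[RHS]opprB subrX1 addrAC subrr sub0r mulNr opprK mulrC.
Qed.

End Stopping.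

Theorem theorem7 (R : realType) (n : nat) (hn : (1 <= n)%N) :
  exists r : stopping_rule R n.-1 n,
  forall F : probability R R, continuous_distribution F ->
  forall (d : measure_display) (Omega : measurableType d)
    (P : probability Omega R)
    (S : 'I_n.-1 -> {RV P >-> R}) (X : 'I_n -> {RV P >-> R})
    (tau : Omega -> option 'I_n),
  iid F (joint_family S X) ->
  is_stopping_time S X r tau ->
  ('E_P[stopped_value X tau]
   = (1 - (1 - n%:R^-1) ^+ n)%:E * 'E_P[max_value X])%E.
Proof.
(* The draw has size [n - 1], so that with the current value it makes [n] entries; the [n - 1]
   samples just suffice for it at the first step. *)
exists (fresh_sample_rule R n.-1 n n.-1) => F Fcont d Omega P S X tau iidY htau.
by apply: (expectation_stopped_value Fcont iidY htau) => //; rewrite prednK.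
Qed.
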